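(* Let $G$ be a perfect graph. The Hansen polytope $\mathrm{H}(G)$ is a Hanner polytope if and only if $G$ is a threshold graph.
   Context: All graphs are finite and simple, and all polytopes are convex. A graph $G$ is perfect if for every induced subgraph $H$ of $G$ the size of the largest clique of $H$ equals the chromatic number of $H$. For a graph $G=(V,E)$, the stable set polytope is $\mathrm{stab}(G)=\mathrm{conv}\{\sum_{i\in I}e_i : I\subseteq V \text{ stable}\}\subseteq\mathbb{R}^{V}$, where $e_i$ denotes the $i$th coordinate unit vector (the empty set is stable). The twisted prism of a polytope $P\subseteq\mathbb{R}^n$ is $\mathrm{tp}(P)=\mathrm{conv}(Q\cup -Q)\subseteq\mathbb{R}^{n+1}$ with $Q=\{1\}\times P$. The Hansen polytope of $G$ is $\mathrm{H}(G)=\mathrm{tp}(\mathrm{stab}(G))$. A polytope $P\subseteq\mathbb{R}^d$ is a Hanner polytope if it is either a centrally symmetric line segment or, for $d\ge 2$, the direct product of two Hanner polytopes or the polar of a Hanner polytope. A node of a graph is dominating if it is adjacent to all other nodes, and isolated if it is not adjacent to any other node. A graph is a threshold graph if it can be constructed from the empty graph (the graph with no nodes) by repeatedly adding either an isolated node or a dominating node.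
   Formalization: Hanner polytopes are taken up to invertible linear maps of the ambient space; with products of coordinate spaces only, the claim would fail, e.g. for the one-node graph, whose Hansen polytope is the slanted parallelogram conv{±(1,0), ±(1,1)}. *)

(* Defs.v *)
From mathcomp Require Import all_boot all_order all_algebra.
From mathcomp Require Import boolp classical_sets reals convex.

Set Implicit Arguments.
Unset Strict Implicit.
Unset Printing Implicit Defensive.

Import Order.TTheory GRing.Theory Num.Theory.

Local Open Scope classical_set_scope.
Local Open Scope ring_scope.

(** * Graphs *)

Record sgraph := SGraph {
  vertex :> finType;
  edge : rel vertex;
  edge_sym : symmetric edge;
  edge_irrefl : irreflexive edge }.

Section Graphs.
Variable G : sgraph.
Implicit Types (S : {set G}) (v : G).

Definition induced_rel (S : {set G}) : rel {x : G | x \in S} :=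
  [rel x y | edge (val x) (val y)].
Arguments induced_rel : clear implicits.

Lemma induced_sym S : symmetric (induced_rel S).
Proof. by move=> x y; exact: edge_sym. Qed.

Lemma induced_irrefl S : irreflexive (induced_rel S).
Proof. by move=> x; exact: edge_irrefl. Qed.

Definition induced S : sgraph := SGraph (@induced_sym S) (@induced_irrefl S).

Definition clique S : bool :=
  [forall x in S, forall y in S, (x != y) ==> edge x y].

Definition stable S : bool :=
  [forall x in S, forall y in S, ~~ edge x y].

Definition clique_number : nat := \max_(S : {set G} | clique S) #|S|.

Definition colorable (k : nat) : bool :=
  [exists f : {ffun G -> 'I_k}, forall x, forall y,
     edge x y ==> (f x != f y)].

Lemma exists_colorable : exists k, colorable k.
Proof.
exists #|G|; apply/existsP; exists [ffun x => enum_rank x].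
apply/forallP => x; apply/forallP => y; apply/implyP => xy.
rewrite !ffunE; apply: contraTneq xy => /enum_rank_inj ->.
by rewrite edge_irrefl.
Qed.

Definition chromatic_number : nat := ex_minn exists_colorable.

Definition isolated v : bool := [forall u, (u != v) ==> ~~ edge v u].
Definition dominating v : bool := [forall u, (u != v) ==> edge v u].

End Graphs.

Definition perfect (G : sgraph) : Prop :=
  forall S : {set G},
    clique_number (induced S) = chromatic_number (induced S).

(** [G] is obtained from [G - v] by adding the node [v]; the formulation by
    induced subgraphs makes the class closed under graph isomorphism. *)
Inductive threshold : sgraph -> Prop :=
| threshold_empty (G : sgraph) : #|G| = 0%N -> threshold G
| threshold_isolated (G : sgraph) (v : G) :
    isolated v -> threshold (induced [set~ v]%SET) -> threshold G
| threshold_dominating (G : sgraph) (v : G) :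
    dominating v -> threshold (induced [set~ v]%SET) -> threshold G.

(** * Polytopes, as sets of row vectors *)

Section Polytopes.
Variable R : realType.

Definition conv_hull (E : lmodType R) (A : set E) : set E :=
  smallest (@convex_set R E) A.

(** The coordinates of [R^V] are listed in the order of [enum V]. *)
Definition incidence (G : sgraph) (I : {set G}) : 'rV[R]_#|G| :=
  \row_j (enum_val j \in I)%:R.

Definition stab (G : sgraph) : set 'rV[R]_#|G| :=
  conv_hull [set incidence I | I in [set I : {set G} | stable I]].

Definition twisted_prism (n : nat) (P : set 'rV[R]_n) : set 'rV[R]_(1 + n) :=
  let Q := [set row_mx 1%:M x | x in P] in
  conv_hull (Q `|` [set - x | x in Q]).

Definition Hansen (G : sgraph) : set 'rV[R]_(1 + #|G|) :=
  twisted_prism (@stab G).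

Definition direct_product (m n : nat) (P : set 'rV[R]_m) (Q : set 'rV[R]_n) :
    set 'rV[R]_(m + n) :=
  [set row_mx x y | x in P & y in Q].

Definition polar (n : nat) (P : set 'rV[R]_n) : set 'rV[R]_n :=
  [set y : 'rV[R]_n | forall x, P x -> \sum_j x 0 j * y 0 j <= 1].

(** Hanner polytopes in standard position: products are taken along blocks of
    coordinates. The polytope is full-dimensional in its ambient space. *)
Inductive std_Hanner : forall d : nat, set 'rV[R]_d -> Prop :=
| std_Hanner_segment (a : R) :
    0 < a -> @std_Hanner 1 [set x : 'rV[R]_1 | - a <= x 0 0 <= a]
| std_Hanner_product (m n : nat) (P : set 'rV[R]_m) (Q : set 'rV[R]_n) :
    std_Hanner P -> std_Hanner Q -> std_Hanner (direct_product P Q)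
| std_Hanner_polar (d : nat) (P : set 'rV[R]_d) :
    (2 <= d)%N -> std_Hanner P -> std_Hanner (polar P).

(** The property of being a Hanner polytope does not depend on the choice of
    linear coordinates: already the Hansen polytope of the one-node graph is
    a parallelogram that is not in standard position. *)
Definition Hanner (d : nat) (P : set 'rV[R]_d) : Prop :=
  exists (Q : set 'rV[R]_d) (A : 'M[R]_d),
    [/\ std_Hanner Q, A \in unitmx & P = [set x *m A | x in Q]].

End Polytopes.

Arguments stab R G : clear implicits.
Arguments Hansen R G : clear implicits.

(* Main.v *)
Require Import Defs.
From mathcomp Require Import all_boot all_order all_algebra.
From mathcomp Require Import boolp classical_sets reals convex.
From mathcomp Require Import interval_inference lra ring.

Set Implicit Arguments.
Unset Strict Implicit.
Unset Printing Implicit Defensive.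

Import Order.TTheory GRing.Theory Num.Theory.

Local Open Scope classical_set_scope.
Local Open Scope ring_scope.

(** Write [vert I] for the vector (1, 1_I), so that the Hansen polytope of an
    induced subgraph G[S] is the convex hull of the points [vert I] and
    [- vert I], for I a stable subset of S. Both directions proceed by peeling
    off vertices that are isolated or dominating.

    Threshold graphs give Hanner polytopes because an isolated vertex turns the
    Hansen polytope into its product with a segment, up to a shear
    ([Hanner_isolated]), and a dominating vertex turns it into its free sum
    with a segment, that is, into the polar of the product of its polar with a
    segment ([Hanner_dominating]).

    Conversely, polarity is an involution on Hanner polytopes, so that a Hanner
    polytope of dimension at least two is a product or the polar of a product
    ([std_Hanner_shape]). An extreme point of the polar of a product P x Q lies
    in one of the two complementary coordinate subspaces
    ([extreme_polar_product]). This is applied to two families of extreme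
    points:
    - if the Hansen polytope is the polar of a product, to its own vertices
      [vert I] ([stable_extreme]);
    - if it is a product, to the extreme points of its polar given by the
      cliques C, which are the linear forms x |-> - x_0 + 2 x(C)
      ([clique_extreme]).
    Either family is thus split between two complementary subspaces, which
    strongly restricts its linear relations. In the polar case let T be the set of the
    vertices i such that [vert [set i]] and [vert set0] lie in different
    subspaces. A stable pair {i, j} with i in T would give
    [vert [set i; j] = vert [set i] + vert [set j] - vert set0], which has
    components in both subspaces; so T consists of dominating vertices
    ([sum_split]). In the product case the same relation between the forms of
    the cliques shows that a set T of vertices is isolated ([product_split]).
    In both cases T is nonempty, for dimension reasons, and one of the two
    factors, or its polar, is linearly isomorphic to the Hansen polytope of
    G[S \ T]. By induction every nonempty induced subgraph has an isolated or a
    dominating vertex, which characterizes threshold graphs. *)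

(** * Convexity and scalar products *)

Section Convexity.
Variables (R : realType) (E : lmodType R).
Implicit Types (A : set E) (x y : E).

Lemma convex_setE A : @convex_set R E A <->
  forall t x y, 0 <= t -> t <= 1 -> A x -> A y -> A (t *: x + (1 - t) *: y).
Proof.
split=> [cA t x y t0 t1 Ax Ay|cA x y t].
  have /= := cA x y (Itv01 t0 t1).
  by rewrite !inE; apply.
by rewrite !inE => Ax Ay; apply: cA.
Qed.

Lemma conv_hull_min A (B : set E) :
  (forall t x y, 0 <= t -> t <= 1 -> B x -> B y -> B (t *: x + (1 - t) *: y)) ->
  A `<=` B -> @conv_hull R E A `<=` B.
Proof. by move=> /convex_setE cB AB; apply: smallest_sub. Qed.

Lemma sub_conv_hull A : A `<=` @conv_hull R E A.
Proof. exact: sub_gen_smallest. Qed.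

Lemma convex_conv_hull A t x y : 0 <= t -> t <= 1 ->
  @conv_hull R E A x -> @conv_hull R E A y ->
  @conv_hull R E A (t *: x + (1 - t) *: y).
Proof.
move=> t0 t1 Ax Ay B [cB AB]; move/convex_setE: (cB); apply => //.
- exact: (Ax B).
- exact: (Ay B).
Qed.

Definition extreme A x := A x /\ forall t u w, 0 < t -> t < 1 -> A u -> A w ->
  x = t *: u + (1 - t) *: w -> u = x.

End Convexity.

Section Dot.
Variable R : realType.

Definition dot n (x y : 'rV[R]_n) : R := \sum_j x 0 j * y 0 j.

Lemma dotC n (x y : 'rV[R]_n) : dot x y = dot y x.
Proof. by apply: eq_bigr => j _; rewrite mulrC. Qed.

Lemma dotDl n (x y z : 'rV[R]_n) : dot (x + y) z = dot x z + dot y z.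
Proof.
by rewrite -big_split; apply: eq_bigr => j _; rewrite mxE mulrDl.
Qed.

Lemma dotZl n a (x z : 'rV[R]_n) : dot (a *: x) z = a * dot x z.
Proof. by rewrite /dot mulr_sumr; apply: eq_bigr => j _; rewrite mxE mulrA. Qed.

Lemma dotDr n (x y z : 'rV[R]_n) : dot x (y + z) = dot x y + dot x z.
Proof. by rewrite dotC dotDl !(dotC x). Qed.

Lemma dotZr n a (x z : 'rV[R]_n) : dot x (a *: z) = a * dot x z.
Proof. by rewrite dotC dotZl dotC. Qed.

Lemma dotNl n (x z : 'rV[R]_n) : dot (- x) z = - dot x z.
Proof. by rewrite -scaleN1r dotZl mulN1r. Qed.

Lemma dotNr n (x z : 'rV[R]_n) : dot x (- z) = - dot x z.
Proof. by rewrite dotC dotNl dotC. Qed.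

Lemma dot0l n (z : 'rV[R]_n) : dot 0 z = 0.
Proof. by rewrite -(scale0r 0) dotZl mul0r. Qed.

Lemma dot0r n (z : 'rV[R]_n) : dot z 0 = 0.
Proof. by rewrite dotC dot0l. Qed.

Lemma dot_gt0 n (x : 'rV[R]_n) : x != 0 -> 0 < dot x x.
Proof.
move=> x0; rewrite lt_neqAle eq_sym sumr_ge0 ?andbT; last first.
  by move=> j _; rewrite -expr2 sqr_ge0.
apply: contraNneq x0 => /eqP.
rewrite psumr_eq0; last by move=> j _; rewrite -expr2 sqr_ge0.
move=> /allP x0; apply/eqP/rowP => j; rewrite mxE.
have /(_ (mem_index_enum j)) := x0 j.
by rewrite mulf_eq0 orbb => /eqP.
Qed.

Lemma dot_row_mx m n (x y : 'rV[R]_m) (z w : 'rV[R]_n) :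
  dot (row_mx x z) (row_mx y w) = dot x y + dot z w.
Proof.
rewrite /dot big_split_ord /=; congr (_ + _); apply: eq_bigr => j _.
  by rewrite !row_mxEl.
by rewrite !row_mxEr.
Qed.

Lemma dot_mulmx m n (z : 'rV[R]_m) (A : 'M[R]_(m, n)) (c : 'rV[R]_n) :
  dot z (c *m A^T) = dot (z *m A) c.
Proof.
have dotE k (x y : 'rV[R]_k) : dot x y = (x *m y^T) 0 0.
  by rewrite mxE; apply: eq_bigr => j _; rewrite mxE.
by rewrite !dotE trmx_mul trmxK mulmxA.
Qed.

Lemma polar_productE m n (P : set 'rV[R]_m) (Q : set 'rV[R]_n) y z :
  polar (direct_product P Q) (row_mx y z) <->
  forall p q, P p -> Q q -> dot p y + dot q z <= 1.
Proof.
split=> [h p q Pp Qq|h x [p Pp [q Qq <-]]].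
  by rewrite -dot_row_mx; apply: h; exists p => //; exists q.
by rewrite -/(dot _ _) dot_row_mx; apply: h.
Qed.

Lemma direct_productE m n (P : set 'rV[R]_m) (Q : set 'rV[R]_n) y z :
  direct_product P Q (row_mx y z) <-> P y /\ Q z.
Proof.
split=> [[p Pp [q Qq /eq_row_mx [<- <-]]] //|[Py Qz]].
by exists y => //; exists z.
Qed.

Definition absorbing n (P : set 'rV[R]_n) :=
  forall x, exists2 e, 0 < e & P (e *: x).

(** The second condition amounts to boundedness; this form makes it visible that
    polarity preserves the conjunction. *)
Definition body n (P : set 'rV[R]_n) :=
  [/\ absorbing P, absorbing (polar P) & polar (polar P) = P].

Lemma body0 n (P : set 'rV[R]_n) : body P -> P 0.
Proof. by case=> /(_ 0) [e _]; rewrite scaler0. Qed.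

Lemma body_polar n (P : set 'rV[R]_n) : body P -> body (polar P).
Proof. by case=> aP aP' bP; split; rewrite // bP. Qed.

Lemma polar_star n (P : set 'rV[R]_n) x t : 0 <= t -> t <= 1 ->
  polar P x -> polar P (t *: x).
Proof.
move=> t0 t1 Px p Pp; rewrite -/(dot _ _) dotZr.
have := Px p Pp; rewrite -/(dot _ _); nra.
Qed.

Lemma body_star n (P : set 'rV[R]_n) x t : body P -> 0 <= t -> t <= 1 ->
  P x -> P (t *: x).
Proof. by case=> _ _ <- ? ?; exact: polar_star. Qed.

Lemma polar_convex n (P : set 'rV[R]_n) t x y : 0 <= t -> t <= 1 ->
  polar P x -> polar P y -> polar P (t *: x + (1 - t) *: y).
Proof.
move=> t0 t1 Px Py p Pp; rewrite -/(dot _ _) dotDr !dotZr.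
have := Px p Pp; have := Py p Pp; rewrite -!/(dot _ _); nra.
Qed.

Lemma sub_bipolar n (P : set 'rV[R]_n) : P `<=` polar (polar P).
Proof. by move=> x Px y Py; rewrite -/(dot _ _) dotC; exact: Py. Qed.

(** Bipolarity passes to products because [row_mx y 0] is in the polar of
    [P x Q] as soon as [y] is in the polar of [P]; no separation theorem is
    involved. *)
Lemma body_product m n (P : set 'rV[R]_m) (Q : set 'rV[R]_n) :
  body P -> body Q -> body (direct_product P Q).
Proof.
move=> bP bQ; have [aP aP' bpP] := bP; have [aQ aQ' bpQ] := bQ.
split.
- move=> x; rewrite -(hsubmxK x).
  have [e e0 Pe] := aP (lsubmx x); have [f f0 Qf] := aQ (rsubmx x).
  have key g : 0 < g -> 0 <= Num.min e f / g.
    by move=> g0; rewrite divr_ge0 ?ltW// lt_min e0.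
  exists (Num.min e f); first by rewrite lt_min e0.
  rewrite scale_row_mx; apply/direct_productE; split.
    have h : Num.min e f / e <= 1 by rewrite ler_pdivrMr // mul1r ge_min lexx.
    have -> : Num.min e f = Num.min e f / e * e by rewrite divfK ?gt_eqF.
    by rewrite -scalerA; apply: body_star => //; exact: key.
  have h : Num.min e f / f <= 1.
    by rewrite ler_pdivrMr // mul1r ge_min lexx orbT.
  have -> : Num.min e f = Num.min e f / f * f by rewrite divfK ?gt_eqF.
  by rewrite -scalerA; apply: body_star => //; exact: key.
- move=> x; rewrite -(hsubmxK x).
  have [e e0 Pe] := aP' (lsubmx x); have [f f0 Qf] := aQ' (rsubmx x).
  (* the harmonic scale makes the two bounds e'/e and e'/f add up to 1 *)
  exists (e * f / (e + f)); first by rewrite divr_gt0 ?mulr_gt0 ?addr_gt0.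
  rewrite scale_row_mx; apply/polar_productE => p q Pp Qq.
  have := Pe p Pp; have := Qf q Qq; rewrite -!/(dot _ _) !dotZr => h1 h2.
  rewrite -mulrDr mulrAC ler_pdivrMr ?addr_gt0 //.
  nra.
- apply/seteqP; split; last exact: sub_bipolar.
  move=> x; rewrite -(hsubmxK x) => Hx; apply/direct_productE.
  rewrite -[X in X (lsubmx x)]bpP -[X in X (rsubmx x)]bpQ.
  split=> y Py.
    have /Hx : polar (direct_product P Q) (row_mx y 0).
      apply/polar_productE => p q Pp Qq; rewrite dot0r addr0; exact: Py.
    by rewrite -/(dot _ _) dot_row_mx dot0l addr0.
  have /Hx : polar (direct_product P Q) (row_mx 0 y).
    apply/polar_productE => p q Pp Qq; rewrite dot0r add0r; exact: Py.
  by rewrite -/(dot _ _) dot_row_mx dot0l add0r.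
Qed.

Definition segment (a : R) : set 'rV[R]_1 := [set x | - a <= x 0 0 <= a].

Lemma dot1 (x y : 'rV[R]_1) : dot x y = x 0 0 * y 0 0.
Proof. exact: big_ord1. Qed.

Lemma polar_segment a : 0 < a -> polar (segment a) = segment a^-1.
Proof.
move=> a0; have a0' : 0 < a^-1 by rewrite invr_gt0.
have aa : a * a^-1 = 1 by rewrite divff ?gt_eqF.
apply/seteqP; split => y.
  move=> h; have := h (const_mx a); have := h (const_mx (- a)).
  rewrite -!/(dot _ _) !dot1 /segment /= !mxE => h1 h2.
  have s1 : - a <= a by lra.
  have {}h1 : - a * y 0 0 <= 1 by apply: h1; rewrite lexx s1.
  have {}h2 : a * y 0 0 <= 1 by apply: h2; rewrite lexx s1.
  by apply/andP; split; nra.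
move=> /= /andP[y1 y2] x /= /andP[x1 x2]; rewrite -/(dot _ _) dot1.
nra.
Qed.

Lemma body_segment a : 0 < a -> body (segment a).
Proof.
have ab b : 0 < b -> absorbing (segment b).
  move=> b0 x; exists (b / (1 + `|x 0 0|)); first by rewrite divr_gt0 // ltr_pwDl.
  rewrite /segment /= mxE -ler_norml normrM ger0_norm; last first.
    by rewrite divr_ge0 ?ltW // ltr_pwDl.
  rewrite mulrAC ler_pdivrMr ?ltr_pwDl //.
  have := normr_ge0 (x 0 0); nra.
move=> a0; have a0' : 0 < a^-1 by rewrite invr_gt0.
by split; rewrite ?polar_segment ?invrK //; exact: ab.
Qed.

Lemma std_Hanner_body n (P : set 'rV[R]_n) : std_Hanner P -> body P.
Proof.
elim=> {n P} [a|m n P Q _ bP _ bQ|n P _ _]; first exact: body_segment.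
- exact: body_product.
- exact: body_polar.
Qed.

Lemma std_Hanner_dim_gt0 n (P : set 'rV[R]_n) : std_Hanner P -> (0 < n)%N.
Proof.
by elim=> {n P} [//|m n P Q _ m0 _ _|n P /ltnW//]; rewrite addn_gt0 m0.
Qed.

(** Polarity preserves Hanner polytopes in dimension one as well. *)
Lemma std_Hanner_polarW n (P : set 'rV[R]_n) : std_Hanner P -> std_Hanner (polar P).
Proof.
move=> hP; case: (hP) => [a a0|m k P1 P2 h1 h2|k P1 k2 h].
- by rewrite polar_segment //; apply: std_Hanner_segment; rewrite invr_gt0.
- apply: std_Hanner_polar; last exact: std_Hanner_product.
  by rewrite -addn1 leq_add // (std_Hanner_dim_gt0 h1, std_Hanner_dim_gt0 h2).
- by have [_ _ ->] := std_Hanner_body h.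
Qed.

(** Since polarity is an involution on Hanner polytopes, at most one polarity
    has to follow the last product. *)
Lemma std_Hanner_shape (T : forall n, set 'rV[R]_n -> Prop) :
  (forall a, 0 < a -> T 1%N (segment a)) ->
  (forall m n (P : set 'rV_m) (Q : set 'rV_n), std_Hanner P -> std_Hanner Q ->
    T _ (direct_product P Q)) ->
  (forall m n (P : set 'rV_m) (Q : set 'rV_n), std_Hanner P -> std_Hanner Q ->
    T _ (polar (direct_product P Q))) ->
  forall n (P : set 'rV_n), std_Hanner P -> T n P.
Proof.
move=> Ts Tx Tp n P hP.
suff [] : T n P /\ ((1 < n)%N -> T n (polar P)) by [].
elim: hP => {n P} [a a0|m n P Q hP _ hQ _|n P n2 hP [TP TP']].
- by split=> //; exact: Ts.
- by split=> [|_]; [exact: Tx|exact: Tp].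
- have [_ _ ->] := std_Hanner_body hP.
  by split=> [|_]; [exact: TP'|].
Qed.

(** The polar of a product is the convex hull of the union of the polars of
    the factors, which lie in complementary subspaces. The point [(y, z)] with
    both components nonzero is cut by the support function of [P] at [y] into
    a point of either subspace. *)
Lemma extreme_polar_product m n (P : set 'rV[R]_m) (Q : set 'rV[R]_n) y z :
  body P -> body Q -> extreme (polar (direct_product P Q)) (row_mx y z) ->
  y = 0 \/ z = 0.
Proof.
move=> bP bQ [/polar_productE h ext].
case: (eqVneq y 0) => [->|y0]; first by left.
case: (eqVneq z 0) => [->|z0]; first by right.
have [aP _ _] := bP; have [aQ _ _] := bQ.
pose A := [set dot p y | p in P].
have ubA q : Q q -> ubound A (1 - dot q z).
  by move=> Qq _ [p Pp <-]; have := h p q Pp Qq; lra.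
have A0 : A !=set0 by exists (dot 0 y); exists 0 => //; exact: body0.
have supA : has_sup A.
  by split=> //; exists (1 - dot 0 z); apply: ubA; exact: body0.
pose a := sup A.
have le_a p : P p -> dot p y <= a.
  by move=> Pp; apply: sup_upper_bound => //; exists p.
have a_le q : Q q -> dot q z <= 1 - a.
  by move=> Qq; have := ge_sup A0 (ubA q Qq); rewrite -/a; lra.
have a_gt0 : 0 < a.
  have [e e0 Pe] := aP y; apply: lt_le_trans (le_a _ Pe).
  by rewrite dotZl mulr_gt0 // dot_gt0.
have a_lt1 : 0 < 1 - a.
  have [e e0 Qe] := aQ z; apply: lt_le_trans (a_le _ Qe).
  by rewrite dotZl mulr_gt0 // dot_gt0.
have h1 : polar (direct_product P Q) (row_mx (a^-1 *: y) 0).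
  apply/polar_productE => p q Pp Qq.
  by rewrite dot0r addr0 dotZr mulrC ler_pdivrMr // mul1r le_a.
have h2 : polar (direct_product P Q) (row_mx 0 ((1 - a)^-1 *: z)).
  apply/polar_productE => p q Pp Qq.
  by rewrite dot0r add0r dotZr mulrC ler_pdivrMr // mul1r a_le.
right; have : row_mx (a^-1 *: y) 0 = row_mx y z.
  apply: (ext a _ _ a_gt0 _ h1 h2); first lra.
  rewrite !scale_row_mx !scaler0 !scalerA !divff ?gt_eqF // !scale1r.
  by rewrite add_row_mx addr0 add0r.
by case/eq_row_mx.
Qed.

End Dot.

(** * Hansen polytopes of induced subgraphs *)

Section HansenPolytopes.
Variables (R : realType) (G : sgraph).

Local Notation N := (1 + #|G|)%N.
Implicit Types (x y : 'rV[R]_N) (S I C : {set G}) (v i j : G).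

Definition height x : R := x 0 (lshift _ 0).
Definition coord v x : R := x 0 (rshift 1 (enum_rank v)).

Lemma heightD x y : height (x + y) = height x + height y.
Proof. by rewrite /height mxE. Qed.
Lemma heightZ a x : height (a *: x) = a * height x.
Proof. by rewrite /height mxE. Qed.
Lemma heightN x : height (- x) = - height x.
Proof. by rewrite /height mxE. Qed.
Lemma height0 : height 0 = 0.
Proof. by rewrite /height mxE. Qed.
Lemma coordD v x y : coord v (x + y) = coord v x + coord v y.
Proof. by rewrite /coord mxE. Qed.
Lemma coordZ v a x : coord v (a *: x) = a * coord v x.
Proof. by rewrite /coord mxE. Qed.
Lemma coordN v x : coord v (- x) = - coord v x.
Proof. by rewrite /coord mxE. Qed.
Lemma coord0 v : coord v 0 = 0.
Proof. by rewrite /coord mxE. Qed.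

Lemma coord_sum v (T : finType) (P : pred T) (F : T -> 'rV[R]_N) :
  coord v (\sum_(i | P i) F i) = \sum_(i | P i) coord v (F i).
Proof. by rewrite /coord summxE. Qed.

Lemma height_sum (T : finType) (P : pred T) (F : T -> 'rV[R]_N) :
  height (\sum_(i | P i) F i) = \sum_(i | P i) height (F i).
Proof. by rewrite /height summxE. Qed.

Lemma coordP x y :
  height x = height y -> (forall v, coord v x = coord v y) -> x = y.
Proof.
move=> h c; apply/rowP => k; rewrite -(splitK k).
case: split => j /=; first by rewrite (ord1 j); exact: h.
by rewrite -(enum_valK j); exact: c.
Qed.

Definition vert I : 'rV[R]_N := row_mx 1%:M (incidence R I).

Lemma height_vert I : height (vert I) = 1.
Proof. by rewrite /height row_mxEl mxE. Qed.

Lemma coord_vert v I : coord v (vert I) = (v \in I)%:R.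
Proof. by rewrite /coord row_mxEr mxE enum_rankK. Qed.

Definition lin := (heightD, heightZ, heightN, height0, coordD, coordZ, coordN,
  coord0, height_vert, coord_vert).

(** The polytope of the subgraph induced by [S], kept inside the ambient space
    of [G] so that all induced subgraphs share one coordinate system. *)
Definition hansen S : set 'rV[R]_N :=
  conv_hull [set x | exists I, [/\ stable I, I \subset S &
    x = vert I \/ x = - vert I]].

Lemma stableP I :
  reflect (forall i j, i \in I -> j \in I -> ~~ edge i j) (stable I).
Proof.
apply: (iffP forallP) => [h i j iI jI|h i].
  by move/implyP: (h i) => /(_ iI) /forallP /(_ j) /implyP; apply.
by apply/implyP => iI; apply/forallP => j; apply/implyP; exact: h.
Qed.

Lemma cliqueP C :
  reflect (forall i j, i \in C -> j \in C -> i != j -> edge i j) (clique C).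
Proof.
apply: (iffP forallP) => [h i j iI jI|h i].
  by move/implyP: (h i) => /(_ iI) /forallP /(_ j) /implyP /(_ jI) /implyP.
by apply/implyP => iI; apply/forallP => j; apply/implyP => jI; apply/implyP; exact: h.
Qed.

Lemma stable0 : stable (@finset.set0 G).
Proof. by apply/stableP => i j; rewrite finset.in_set0. Qed.

Lemma stable1 i : stable [set i]%SET.
Proof. by apply/stableP => j k /set1P -> /set1P ->; rewrite edge_irrefl. Qed.

Lemma stable2 i j : ~~ edge i j -> stable [set i; j]%SET.
Proof.
move=> ij; apply/stableP => k l /set2P[]-> /set2P[]->; rewrite ?edge_irrefl //.
by rewrite edge_sym.
Qed.

Lemma clique0 : clique (@finset.set0 G).
Proof. by apply/cliqueP => i j; rewrite finset.in_set0. Qed.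

Lemma clique1 i : clique [set i]%SET.
Proof. by apply/cliqueP => j k /set1P -> /set1P ->; rewrite eqxx. Qed.

Lemma clique2 i j : edge i j -> clique [set i; j]%SET.
Proof.
move=> ij; apply/cliqueP => k l /set2P[]-> /set2P[]-> //; rewrite ?eqxx //.
by rewrite edge_sym.
Qed.

Lemma stableS (I J : {set G}) : I \subset J -> stable J -> stable I.
Proof.
move=> /fintype.subsetP IJ /stableP h; apply/stableP => i j iI jI.
by apply: h; exact: IJ.
Qed.

Lemma hansen_vert S I : stable I -> I \subset S -> hansen S (vert I).
Proof. by move=> sI IS; apply: sub_conv_hull; exists I; split=> //; left. Qed.

Lemma hansen_vertN S I : stable I -> I \subset S -> hansen S (- vert I).
Proof. by move=> sI IS; apply: sub_conv_hull; exists I; split=> //; right. Qed.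

Lemma hansen_convex S t x y : 0 <= t -> t <= 1 ->
  hansen S x -> hansen S y -> hansen S (t *: x + (1 - t) *: y).
Proof. exact: convex_conv_hull. Qed.

Lemma hansen_min S (B : set 'rV[R]_N) :
  (forall t x y, 0 <= t -> t <= 1 -> B x -> B y -> B (t *: x + (1 - t) *: y)) ->
  (forall I, stable I -> I \subset S -> B (vert I) /\ B (- vert I)) ->
  hansen S `<=` B.
Proof.
move=> cB h; apply: conv_hull_min => // x [I [sI IS [] ->]].
  by case: (h I sI IS).
by case: (h I sI IS).
Qed.

Lemma hansen0 S : hansen S 0.
Proof.
have := @hansen_convex S (2^-1) (vert finset.set0) (- vert finset.set0).
have -> : 1 - 2^-1 = 2^-1 :> R by lra.
rewrite scalerN subrr; apply; rewrite ?invr_ge0 ?invf_le1 ?ler1n ?ler0n //.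
  by apply: hansen_vert; rewrite ?stable0 ?finset.sub0set.
by apply: hansen_vertN; rewrite ?stable0 ?finset.sub0set.
Qed.

Lemma hansen_mono S S' : S \subset S' -> hansen S `<=` hansen S'.
Proof.
move=> SS'; apply: hansen_min => [|I sI IS]; first exact: hansen_convex.
have IS' := fintype.subset_trans IS SS'.
by split; [exact: hansen_vert|exact: hansen_vertN].
Qed.

Lemma hansen_coord S x v : hansen S x -> v \notin S -> coord v x = 0.
Proof.
move=> Hx vS; move: x Hx.
apply: (@hansen_min S [set x | coord v x = 0]) => /=.
  by move=> t x y _ _; rewrite !lin => -> ->; rewrite !mulr0 addr0.
move=> I _ /fintype.subsetP IS; rewrite !lin.
have /negPf-> : v \notin I by apply: contraNN vS => /IS.
by rewrite oppr0.
Qed.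

Lemma hansen_eq0 S x : (forall v, v \notin S -> coord v x = 0) ->
  height x = 0 -> (forall v, v \in S -> coord v x = 0) -> x = 0.
Proof.
move=> h0 h1 h2; apply: coordP => [|v]; rewrite !lin //.
by case: (boolP (v \in S)) => [/h2|/h0].
Qed.

Lemma span_vert S x : (forall v, v \notin S -> coord v x = 0) ->
  x = height x *: vert finset.set0 +
      \sum_(v in S) coord v x *: (vert [set v]%SET - vert finset.set0).
Proof.
move=> h; apply: coordP => [|v].
  rewrite !lin height_sum big1 ?addr0 ?mulr1 // => i _.
  by rewrite !lin subrr mulr0.
rewrite !lin finset.in_set0 mulr0 add0r coord_sum.
case: (boolP (v \in S)) => vS; last first.
  rewrite h // big1 // => i iS; rewrite !lin finset.in_set0 subr0 finset.in_set1.
  by case: eqP => [vi|_]; rewrite ?mulr0 //; rewrite vi iS in vS.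
rewrite (bigD1 v) //= big1 ?addr0; last first.
  by move=> i /andP[_ iv]; rewrite !lin finset.in_set0 finset.in_set1 eq_sym (negPf iv) subrr mulr0.
by rewrite !lin finset.in_set0 finset.set11 subr0 mulr1.
Qed.

Lemma submx_span_vert S m (B : 'M[R]_(m, N)) x :
  (forall v, v \notin S -> coord v x = 0) -> (vert finset.set0 <= B)%MS ->
  (forall i, i \in S -> (vert [set i]%SET <= B)%MS) -> (x <= B)%MS.
Proof.
move=> /span_vert -> v0 v1; rewrite addmx_sub ?scalemx_sub //.
apply: summx_sub => i iS; rewrite scalemx_sub // addmx_sub ?v1 //.
by rewrite eqmx_opp.
Qed.

(** The form -x_0 + 2 x(C) takes only the values 1 and -1 on the vertices of
    the polytope, since a clique meets a stable set at most once. *)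
Definition cvec C : 'rV[R]_N := row_mx (- 1%:M) (2 *: incidence R C).

Lemma dot_cvec C x : dot x (cvec C) = - height x + 2 * \sum_(v in C) coord v x.
Proof.
rewrite /dot big_split_ord big_ord1 /=; congr (_ + _).
  by rewrite row_mxEl !mxE mulrN mulr1.
rewrite mulr_sumr [RHS]big_mkcond (reindex_onto enum_rank enum_val) /=; last first.
  by move=> i _; rewrite enum_valK.
rewrite big_mkcond; apply: eq_bigr => v _.
rewrite enum_rankK eqxx row_mxEr !mxE enum_rankK -/(coord v x).
by case: (v \in C); rewrite /= ?mulr0 // mulr1 mulrC.
Qed.

Lemma dot_cvec0 x : dot x (cvec finset.set0) = - height x.
Proof. by rewrite dot_cvec big_set0 mulr0 addr0. Qed.

Lemma dot_cvec1 x i : dot x (cvec [set i]%SET) = - height x + 2 * coord i x.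
Proof. by rewrite dot_cvec big_set1. Qed.

Lemma dot_cvec2 x i j : i != j ->
  dot x (cvec [set i; j]%SET) = - height x + 2 * (coord i x + coord j x).
Proof. by move=> ij; rewrite dot_cvec big_setU1 ?finset.in_set1 // big_set1. Qed.

Lemma clique_stable C I : clique C -> stable I -> (#|C :&: I| <= 1)%N.
Proof.
move=> /cliqueP cC /stableP sI; apply/card_le1_eqP => i j.
rewrite !inE => /andP[iC iI] /andP[jC jI]; apply/eqP/idPn => ij.
by have := cC j i jC iC ij; rewrite (negPf (sI j i jI iI)).
Qed.

Lemma dot_cvec_vert C I : clique C -> stable I ->
  dot (vert I) (cvec C) = 1 \/ dot (vert I) (cvec C) = -1.
Proof.
move=> cC sI; rewrite dot_cvec height_vert.
have -> : \sum_(v in C) coord v (vert I) = #|C :&: I|%:R.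
  rewrite -sum1_card natr_sum big_mkcond [RHS]big_mkcond /=.
  by apply: eq_bigr => v _; rewrite coord_vert inE; case: (v \in C); case: (v \in I).
by have := clique_stable cC sI; case: #|_| => [|[|]] // _; [right|left]; lra.
Qed.

Lemma dot_cvec_le1 C S x : clique C -> hansen S x -> dot x (cvec C) <= 1.
Proof.
move=> cC; move: x; apply: (@hansen_min S [set x | dot x (cvec C) <= 1]) => /=.
  by move=> t x y t0 t1 hx hy; rewrite dotDl !dotZl; nra.
by move=> I sI _; rewrite dotNl; case: (dot_cvec_vert cC sI) => ->; split; lra.
Qed.

Lemma dot_cvec_geN1 C S x : clique C -> hansen S x -> -1 <= dot x (cvec C).
Proof.
move=> cC; move: x; apply: (@hansen_min S [set x | -1 <= dot x (cvec C)]) => /=.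
  by move=> t x y t0 t1 hx hy; rewrite dotDl !dotZl; nra.
by move=> I sI _; rewrite dotNl; case: (dot_cvec_vert cC sI) => ->; split; lra.
Qed.

(** The number 1 is an extreme point of the half-line of the numbers at most 1;
    stated up to the sign [s]. *)
Lemma extreme_value (s t a b : R) : s = 1 \/ s = -1 -> 0 < t -> t < 1 ->
  s * a <= 1 -> s * b <= 1 -> s = t * a + (1 - t) * b -> a = s.
Proof. by case=> -> t0 t1 ha hb h; nra. Qed.

End HansenPolytopes.

(** * Isolated and dominating vertices from a decomposition *)

Section Decomposition.
Variables (R : realType) (G : sgraph).

Local Notation N := (1 + #|G|)%N.
Local Notation vert := (@vert R G).
Local Notation hansen := (@hansen R G).
Local Notation cvec := (@cvec R G).
Implicit Types (x y : 'rV[R]_N) (S I C : {set G}) (v i j : G).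

(** Being a Hanner polytope in its own linear span. *)
Definition Hanner_in (X : set 'rV[R]_N) := exists d (Q : set 'rV[R]_d) A,
  [/\ std_Hanner Q, row_free A & X = [set z *m A | z in Q]].

Lemma hansen_coord_im S d (Q : set 'rV[R]_d) A z v : body Q ->
  hansen S = [set z *m A | z in Q] -> v \notin S -> coord v (z *m A) = 0.
Proof.
case=> aQ _ _ hS vS; have [e e0 Qe] := aQ z.
have : coord v ((e *: z) *m A) = 0.
  by apply: (@hansen_coord _ _ S) => //; rewrite hS; exists (e *: z).
by rewrite -scalemxAl lin => /eqP; rewrite mulf_eq0 gt_eqF //= => /eqP.
Qed.

(** The forms of the empty clique and of the singletons take the values 1 and
    -1 at [vert I] and are bounded by these on the polytope, which therefore is
    contained in a parallelepiped with vertex [vert I]. *)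
Lemma stable_extreme S d (Q : set 'rV[R]_d) A I : row_free A ->
  hansen S = [set z *m A | z in Q] -> stable I -> I \subset S ->
  exists2 z, extreme Q z & vert I = z *m A.
Proof.
move=> fA hS sI IS; have := hansen_vert (R:=R) sI IS; rewrite hS => -[z Qz zE].
exists z => //; split=> // t u w t0 t1 Qu Qw zuw.
have HS q : Q q -> hansen S (q *m A) by move=> Qq; rewrite hS; exists q.
apply: (row_free_inj fA); rewrite /= zE.
have key C : clique C -> dot (u *m A) (cvec C) = dot (vert I) (cvec C).
  move=> cC; apply: (@extreme_value _ _ t _ (dot (w *m A) (cvec C))) => //.
  - exact: dot_cvec_vert.
  - have := dot_cvec_le1 cC (HS u Qu); have := dot_cvec_geN1 cC (HS u Qu).
    by case: (dot_cvec_vert R cC sI) => ->; lra.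
  - have := dot_cvec_le1 cC (HS w Qw); have := dot_cvec_geN1 cC (HS w Qw).
    by case: (dot_cvec_vert R cC sI) => ->; lra.
  - by rewrite -!dotZl -dotDl -zE zuw mulmxDl !scalemxAl.
have := key _ (clique0 G); rewrite !dot_cvec0 => /oppr_inj hh.
apply: coordP => // v; have := key _ (clique1 v).
by rewrite !dot_cvec1 hh; lra.
Qed.

(** The facet of a clique [C] contains, up to sign, the vertices of the empty
    stable set and of all singletons, which span. *)
Lemma clique_extreme S d (Q : set 'rV[R]_d) (A : 'M_(d, N)) C : body Q -> row_free A ->
  hansen S = [set z *m A | z in Q] -> clique C ->
  extreme (polar Q) (cvec C *m A^T).
Proof.
move=> bQ fA hS cC.
have HS q : Q q -> hansen S (q *m A) by move=> Qq; rewrite hS; exists q.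
split=> [q Qq|t u w t0 t1 Pu Pw cE].
  by rewrite -/(dot _ _) dot_mulmx; apply: dot_cvec_le1 (HS q Qq).
pose c := cvec C *m A^T.
have key I : stable I -> I \subset S ->
    dot (vert I *m pinvmx A) u = dot (vert I *m pinvmx A) c.
  move=> sI IS.
  have := hansen_vert (R:=R) sI IS; rewrite hS => -[z Qz zE].
  have := hansen_vertN (R:=R) sI IS; rewrite hS => -[z' Qz' z'E].
  have {z'E} z'E : z' = - z.
    by apply: (row_free_inj fA); rewrite /= z'E mulNmx zE.
  rewrite -zE mulmxKp // /c dot_mulmx zE.
  have := dot_cvec_vert R cC sI; rewrite -{1 2}zE -!dot_mulmx => vE.
  have uz := Pu z Qz; have uz' := Pu z' Qz'.
  have wz := Pw z Qz; have wz' := Pw z' Qz'.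
  move: uz uz' wz wz'; rewrite -!/(dot _ _) z'E !dotNl => uz uz' wz wz'.
  rewrite -zE -dot_mulmx.
  apply: (@extreme_value _ _ t _ (dot z w)) => //.
  - by case: vE => ->; lra.
  - by case: vE => ->; lra.
  - by rewrite cE dotDr !dotZr.
have eq0 z : dot z (u - c) = 0.
  rewrite -(mulmxKp fA z) (@span_vert _ _ S (z *m A)); last first.
    by move=> v; exact: hansen_coord_im hS.
  have key0 I : stable I -> I \subset S -> dot (vert I *m pinvmx A) (u - c) = 0.
    by move=> sI IS; rewrite dotDr dotNr key // subrr.
  have k0 := key0 _ (stable0 G) (finset.sub0set S).
  rewrite mulmxDl -scalemxAl dotDl dotZl k0 mulr0 add0r.
  rewrite mulmx_suml; elim/big_ind: _ => [|x y hx hy|i iS].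
  - by rewrite dot0l.
  - by rewrite dotDl hx hy addr0.
  - rewrite -scalemxAl dotZl mulmxBl dotDl dotNl k0 subr0.
    by rewrite key0 ?mulr0 ?stable1 ?finset.sub1set.
apply/eqP; rewrite -subr_eq0; apply/negPn/negP => /dot_gt0.
by rewrite eq0 ltxx.
Qed.

Section Split.
Variables (m n : nat) (A1 : 'M[R]_(m, N)) (A2 : 'M[R]_(n, N)) (S : {set G}).
Hypothesis n_gt0 : (0 < n)%N.
Hypothesis inj12 : forall (p : 'rV_m) (q : 'rV_n), p *m A1 = q *m A2 -> p = 0 /\ q = 0.

Lemma nonzero_row : exists q : 'rV[R]_n, q != 0.
Proof.
exists (const_mx 1); apply/eqP => /rowP /(_ (Ordinal n_gt0)).
by rewrite !mxE => /eqP; rewrite oner_eq0.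
Qed.

Hypothesis supp2 : forall (q : 'rV_n) v, v \notin S -> coord v (q *m A2) = 0.

(** The vertices of [S] outside of [S'] are those whose form vanishes on the
    first factor; as the form of the empty clique vanishes on the second one,
    the form of an edge at such a vertex would vanish on neither. Projecting
    away the coordinates outside of [S'] kills the second factor, is injective
    on the first one, and maps the polytope of [S] onto that of [S']. *)
Lemma product_split (P : set 'rV[R]_m) (Q : set 'rV[R]_n) :
  std_Hanner P -> std_Hanner Q ->
  (forall x, hansen S x <-> exists p q, [/\ P p, Q q & x = p *m A1 + q *m A2]) ->
  (forall C, clique C -> (forall p, dot (p *m A1) (cvec C) = 0) \/
                         (forall q, dot (q *m A2) (cvec C) = 0)) ->
  (forall q, height (q *m A2) = 0) ->
  exists S', [/\ S' \proper S, Hanner_in (hansen S') &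
    forall i j, i \in S -> i \notin S' -> j \in S -> ~~ edge i j].
Proof.
move=> hP hQ hX hF h2.
have bP := std_Hanner_body hP; have bQ := std_Hanner_body hQ.
have P1E p : exists2 e, 0 < e & hansen S (e *: (p *m A1)).
  have [aP _ _] := bP; have [e e0 Pe] := aP p; exists e => //; apply/hX.
  exists (e *: p), 0; split=> //; first exact: body0.
  by rewrite mul0mx addr0 scalemxAl.
have supp1 p v : v \notin S -> coord v (p *m A1) = 0.
  move=> vS; have [e e0 /hansen_coord/(_ vS)] := P1E p.
  by rewrite lin => /eqP; rewrite mulf_eq0 gt_eqF //= => /eqP.
pose S' := [set i in S | `[< forall q, coord i (q *m A2) = 0 >]]%SET.
have S'P i : reflect (i \in S /\ forall q, coord i (q *m A2) = 0) (i \in S').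
  by rewrite finset.inE; apply: (iffP andP) => -[iS /asboolP].
have S'S : S' \subset S by apply/fintype.subsetP => i /S'P[].
have vE I : stable I -> I \subset S -> exists p q, vert I = p *m A1 + q *m A2.
  by move=> sI IS; have [p [q [_ _ ->]]] := (hX _).1 (hansen_vert (R:=R) sI IS); exists p, q.
have v0E := vE _ (stable0 G) (finset.sub0set S).
have v1E i : i \in S -> exists p q, vert [set i]%SET = p *m A1 + q *m A2.
  by move=> iS; apply: vE; rewrite ?stable1 ?finset.sub1set.
have hT i : i \in S -> i \notin S' ->
    (forall p, 2 * coord i (p *m A1) = height (p *m A1)) /\
    (exists q, coord i (q *m A2) != 0).
  move=> iS iS'.
  have [q q0] : exists q, coord i (q *m A2) != 0.
    apply: contrapT => nq; case/S'P: iS'; split=> // q.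
    by apply/eqP/negPn/negP => qi; apply: nq; exists q.
  split; last by exists q.
  case: (hF _ (clique1 i)) => [h p|/(_ q)].
    by have := h p; rewrite dot_cvec1; lra.
  by rewrite dot_cvec1 h2 => h; case/eqP: q0; lra.
exists S'; split.
- rewrite finset.properEneq S'S andbT; apply/eqP => SE.
  have [q /eqP[]] := nonzero_row.
  have [] // := inj12 (p := 0) (q := q) _.
  rewrite mul0mx; apply/esym/(@hansen_eq0 _ _ S) => // v; first exact: supp2.
  by rewrite -{1}SE => /S'P[].
- exists m, P, (A1 *m diag_mx (vert S')).
  have projh x : height (x *m diag_mx (vert S')) = height x.
    by rewrite /height mul_mx_diag mxE -/(height (vert S')) height_vert mulr1.
  have projc v x : coord v (x *m diag_mx (vert S')) = coord v x * (v \in S')%:R.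
    by rewrite /coord mul_mx_diag mxE -/(coord v (vert S')) coord_vert.
  have projV I : vert I *m diag_mx (vert S') = vert (I :&: S')%SET.
    apply: coordP => [|v]; rewrite ?projh ?projc !lin // finset.in_setI.
    by case: (v \in I); case: (v \in S'); rewrite /= ?mulr1 ?mulr0.
  have projH x : hansen S x -> hansen S' (x *m diag_mx (vert S')).
    move: x; apply: (@hansen_min _ _ S [set x | hansen S' (x *m diag_mx (vert S'))]) => /=.
      move=> t x y t0 t1 hx hy; rewrite mulmxDl -!scalemxAl; exact: hansen_convex.
    move=> I sI _; rewrite mulNmx projV.
    have sI' : stable (I :&: S') by apply: stableS sI; exact: finset.subsetIl.
    by split; [apply: hansen_vert|apply: hansen_vertN]; rewrite ?finset.subsetIr.
  split=> //.
    apply: inj_row_free => p; rewrite mulmxA => p0.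
    have hp : height (p *m A1) = 0 by rewrite -projh p0 lin.
    have [] // := inj12 (p := p) (q := 0) _.
    rewrite mul0mx; apply/(@hansen_eq0 _ _ S) => // v; first exact: supp1.
    move=> vS; case: (boolP (v \in S')) => vS'.
      by have := projc v (p *m A1); rewrite p0 vS' mulr1 lin.
    by have [/(_ p)] := hT v vS vS'; rewrite hp; lra.
  apply/seteqP; split=> [x Hx|_ [p Pp <-]].
    have [p [q [Pp Qq xE]]] := (hX x).1 (hansen_mono S'S Hx).
    exists p => //; rewrite mulmxA.
    have -> : x = x *m diag_mx (vert S').
      apply: coordP => [|v]; rewrite ?projh // projc.
      case: (boolP (v \in S')) => vS'; first by rewrite mulr1.
      by rewrite mulr0 (hansen_coord Hx).
    rewrite xE mulmxDl -[LHS]addr0; congr (_ + _).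
    apply: coordP => [|v]; rewrite ?projh ?projc ?h2 !lin //.
    case: (boolP (v \in S')) => vS'; last by rewrite mulr0.
    by have [_ ->] := S'P _ vS'; rewrite mul0r.
  rewrite mulmxA; apply: projH; apply/hX; exists p, 0; split=> //.
    exact: body0.
  by rewrite mul0mx addr0.
- move=> i j iS iS' jS; apply/negP => ij.
  have neq : i != j by apply: contraTneq ij => ->; rewrite edge_irrefl.
  have [hi1 [q0 hi2]] := hT i iS iS'.
  have [p0 [q00 v0]] := v0E; have [pj [qj vj]] := v1E j jS.
  have v0h := height_vert R (@finset.set0 G).
  have v0c v := @coord_vert R G v finset.set0.
  have vjc := @coord_vert R G j [set j]%SET.
  move: v0h vjc (v0c i) (v0c j); rewrite !finset.in_set0 finset.set11 vj v0 !lin !h2 addr0 /=.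
  move=> v0h vjc v0i v0j.
  (* [vert set0] and [vert [set j]] are sums of points of the two factors, so
     a form vanishing on both factors vanishes at these vertices *)
  case: (hF _ (clique2 ij)) => hij.
    have cj p : coord j (p *m A1) = 0.
      by have := hij p; rewrite dot_cvec2 // -hi1; lra.
    case: (hF _ (clique1 j)) => hj.
      by have := hj p0; rewrite dot_cvec1 cj v0h; lra.
    have := hj qj; rewrite dot_cvec1 h2.
    by move: vjc; rewrite cj; lra.
  have cij q : coord i (q *m A2) = - coord j (q *m A2).
    by have := hij q; rewrite dot_cvec2 // h2; lra.
  case: (hF _ (clique1 j)) => hj.
    have := hj p0; rewrite dot_cvec1 => hj0.
    by move: v0i v0j; rewrite cij; have := hi1 p0; lra.
  have := hj q0; rewrite dot_cvec1 h2 => hj0.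
  by case/eqP: hi2; rewrite cij; lra.
Qed.

(** The vertices of [S] outside of [S'] are those with [vert [set i]] in the
    second subspace, the first one containing [vert set0]. The polytope of [S']
    is the intersection of that of [S] with the first subspace: all other
    vertices of the latter are in the second subspace, so that forgetting them
    in a convex combination changes the point by a vector of that subspace. *)
Lemma sum_split (P : set 'rV[R]_m) (Q : set 'rV[R]_n) :
  std_Hanner P -> std_Hanner Q ->
  (forall x, hansen S x <->
     exists p q, [/\ forall (a : 'rV_m) (b : 'rV_n),
                       P a -> Q b -> dot a p + dot b q <= 1 &
                     x = p *m A1 + q *m A2]) ->
  row_free A1 ->
  (forall I, stable I -> I \subset S ->
     (exists p, vert I = p *m A1) \/ (exists q, vert I = q *m A2)) ->
  (exists p, vert finset.set0 = p *m A1) ->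
  exists S', [/\ S' \proper S, Hanner_in (hansen S') &
    forall i j, i \in S -> i \notin S' -> j \in S -> j != i -> edge i j].
Proof.
move=> hP hQ hX fA1 hF [p0 v0].
have bP := std_Hanner_body hP; have bQ := std_Hanner_body hQ.
pose S' := [set i in S | `[< exists p, vert [set i]%SET = p *m A1 >]]%SET.
have S'P i : reflect (i \in S /\ exists p, vert [set i]%SET = p *m A1) (i \in S').
  by rewrite finset.inE; apply: (iffP andP) => -[iS /asboolP].
have S'S : S' \subset S by apply/fintype.subsetP => i /S'P[].
have hT i : i \in S -> i \notin S' -> exists q, vert [set i]%SET = q *m A2.
  move=> iS iS'; case: (hF [set i]%SET); rewrite ?stable1 ?finset.sub1set // => h.
  by case/S'P: iS'.
have vneq0 I : vert I <> 0.
  move=> /(congr1 (@height R G)); rewrite !lin => /eqP; by rewrite oner_eq0.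
have dom i j : i \in S -> i \notin S' -> j \in S -> j != i -> edge i j.
  move=> iS iS' jS ji; apply/negPn/negP => /stable2 sij.
  have [q vi] := hT i iS iS'.
  have vij : vert [set i; j]%SET =
      vert [set i]%SET + vert [set j]%SET - vert finset.set0.
    apply: coordP => [|v]; rewrite !lin; first by rewrite addrK.
    rewrite !finset.inE subr0.
    case: (eqVneq v i) => [->|_]; last by rewrite add0r.
    by rewrite eq_sym (negPf ji) addr0.
  have ijS : [set i; j]%SET \subset S by rewrite finset.subUset !finset.sub1set iS.
  case: (boolP (j \in S')) => [/S'P[_ [p' vj]]|jS'].
    case: (hF _ sij ijS) => -[r]; rewrite vij vi vj v0 => E.
      have [] // := inj12 (p := r - p' + p0) (q := q) _.
        by rewrite mulmxDl mulmxBl -E addrAC subrK addrK.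
      by move=> _ q0; apply: (vneq0 [set i]%SET); rewrite vi q0 mul0mx.
    have [] // := inj12 (p := p' - p0) (q := r - q) _.
      by rewrite !mulmxBl -E -[X in _ = X - _]addrA [RHS]addrAC subrr add0r.
    move=> /eqP; rewrite subr_eq0 => /eqP p'E _.
    have := congr1 (@coord R G j) vj; rewrite p'E -v0 !lin.
    by rewrite finset.set11 finset.in_set0 => /eqP; rewrite oner_eq0.
  have [q' vj] := hT j jS jS'.
  case: (hF _ sij ijS) => -[r]; rewrite vij vi vj v0 => E.
    have [] // := inj12 (p := r + p0) (q := q + q') _.
      by rewrite !mulmxDl -E subrK.
    move=> _ qq; have := height_vert R [set i]%SET.
    have := height_vert R [set j]%SET.
    rewrite vi vj; have := congr1 (fun z => height (z *m A2)) qq.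
    by rewrite /= mulmxDl mul0mx !lin; lra.
  have [] // := inj12 (p := p0) (q := q + q' - r) _.
    by rewrite mulmxBl mulmxDl -E opprB addrC subrK.
  by move=> p00; case: (vneq0 finset.set0); rewrite v0 p00 mul0mx.
have rangeS' x : hansen S' x -> exists p, x = p *m A1.
  move: x; apply: (@hansen_min _ _ S' [set x | exists p, x = p *m A1]) => /=.
    move=> t x y _ _ [p ->] [p' ->]; exists (t *: p + (1 - t) *: p').
    by rewrite mulmxDl -!scalemxAl.
  move=> I sI IS'.
  have /submxP[p ->] : (vert I <= A1)%MS.
    apply: (@submx_span_vert _ _ S'); rewrite ?v0 ?submxMl //.
      move=> v vS'; have /negPf vI : v \notin I.
        by apply: contraNN vS' => /(fintype.subsetP IS').
      by rewrite lin vI.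
    by move=> i /S'P[_ [p ->]]; exact: submxMl.
  by split; [exists p|exists (- p); rewrite mulNmx].
have decomp x : hansen S x -> exists q, hansen S' (x - q *m A2).
  move: x; apply: (@hansen_min _ _ S [set x | exists q, hansen S' (x - q *m A2)]) => /=.
    move=> t x y t0 t1 [q hq] [r hr]; exists (t *: q + (1 - t) *: r).
    have := hansen_convex t0 t1 hq hr.
    by rewrite !scalerBr mulmxDl -!scalemxAl opprD addrACA.
  move=> I sI IS; case: (boolP (I \subset S')) => IS'.
    split; exists 0; rewrite mul0mx subr0; first exact: hansen_vert.
    exact: hansen_vertN.
  have [i iI iS'] := subsetPn IS'.
  have iS := fintype.subsetP IS _ iI.
  have IE : I = [set i]%SET.
    apply/eqP; rewrite finset.eqEsubset finset.sub1set iI andbT; apply/fintype.subsetP => j jI.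
    rewrite finset.in_set1; apply/negPn/negP => ji.
    have := dom i j iS iS' (fintype.subsetP IS _ jI) ji.
    by rewrite (negPf (stableP _ sI i j iI jI)).
  have [q vi] := hT i iS iS'.
  split; [exists q|exists (- q)]; rewrite IE vi ?mulNmx subrr; exact: hansen0.
exists S'; split=> //.
- rewrite finset.properEneq S'S andbT; apply/eqP => SE.
  have [q /eqP[]] := nonzero_row.
  have /submxP[p pE] : (q *m A2 <= A1)%MS.
    apply: (@submx_span_vert _ _ S); rewrite ?v0 ?submxMl //; first exact: supp2.
    by move=> i; rewrite -SE => /S'P[_ [p ->]]; exact: submxMl.
  by have [] := inj12 (esym pE).
- exists m, (polar P), A1; split=> //; first exact: std_Hanner_polarW.
  apply/seteqP; split=> [x Hx|_ [p Pp <-]].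
    have [p [q [pq xE]]] := (hX x).1 (hansen_mono S'S Hx).
    have [p' xE'] := rangeS' x Hx.
    have [] := inj12 (p := p' - p) (q := q) _.
      by rewrite mulmxBl -xE' xE addrAC subrr add0r.
    move=> /eqP; rewrite subr_eq0 => /eqP p'E _; exists p'; rewrite // p'E.
    by move=> y Py; have := pq y 0 Py (body0 bQ); rewrite dot0l addr0.
  have Hp : hansen S (p *m A1).
    apply/hX; exists p, 0; split; last by rewrite mul0mx addr0.
    by move=> y z Py Qz; rewrite dot0r addr0; exact: Pp.
  have [q Hq] := decomp _ Hp.
  have [p' pE] := rangeS' _ Hq.
  have [] := inj12 (p := p - p') (q := q) _.
    by rewrite mulmxBl -pE opprB addrC subrK.
  by move=> _ q0; move: Hq; rewrite q0 mul0mx subr0.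
Qed.

End Split.
End Decomposition.

(** * Threshold graphs *)

Section Threshold.

(** The induced-subgraph form of thresholdness, which is visibly hereditary. *)
Definition peelable (G : sgraph) (S : {set G}) := forall S' : {set G},
  S' \subset S -> S' != finset.set0 -> exists2 v, v \in S' &
    (forall u, u \in S' -> u != v -> ~~ edge v u) \/
    (forall u, u \in S' -> u != v -> edge v u).

Lemma peelableS (G : sgraph) (S S' : {set G}) :
  S' \subset S -> peelable S -> peelable S'.
Proof. by move=> SS' h T TS'; apply: h; exact: fintype.subset_trans SS'. Qed.

Lemma threshold_peelable (G : sgraph) : threshold G -> peelable [set: G]%SET.
Proof.
have step (H : sgraph) (v : H) : isolated v \/ dominating v ->
    peelable [set: induced [set~ v]%SET]%SET -> peelable [set: H]%SET.
  move=> hv IH S _ S0; case: (boolP (v \in S)) => vS.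
    exists v => //; case: hv => /forallP h; [left|right] => u _.
      by move/implyP: (h u).
    by move/implyP: (h u).
  pose S' : {set induced [set~ v]%SET} := [set x | val x \in S]%SET.
  have lift u : u \in S -> exists2 x : induced [set~ v]%SET, x \in S' & val x = u.
    move=> uS; have uv : u \in [set~ v]%SET.
      by rewrite finset.in_setC finset.in_set1; apply: contraNneq vS => <-.
    by exists (Sub u uv); rewrite ?finset.inE SubK.
  have [||w wS' hw] := IH S'; first exact: finset.subsetT.
    by have /set0Pn[u /lift[x xS' _]] := S0; apply/set0Pn; exists x.
  exists (val w); first by rewrite finset.inE in wS'.
  case: hw => h; [left|right] => _ /lift[x xS' <-]; rewrite (inj_eq val_inj).
    by move=> /h -/(_ xS').
  by move=> /h -/(_ xS').
apply: (threshold_ind (P := fun H => peelable [set: H]%SET)) => {G} [G G0|G v hv _|G v hv _].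
- move=> S _ /set0Pn[x _]; exfalso.
  by move: G0; rewrite (cardD1 x).
- by apply: step; left.
- by apply: step; right.
Qed.

Lemma peelable_threshold (G : sgraph) : peelable [set: G]%SET -> threshold G.
Proof.
have [k ltGk] := ubnP #|G|; elim: k G ltGk => // k IH G ltGk hG.
case: (posnP #|G|) => [|G0]; first exact: threshold_empty.
have [|v _ hv] := hG [set: G]%SET (finset.subsetT _).
  by rewrite -card_gt0 cardsT.
have thr : threshold (induced [set~ v]%SET).
  apply: IH.
    rewrite card_sig; apply: (@leq_trans #|G|) => //; rewrite -[X in (_ < X)%N]cardsT.
    apply: proper_card; apply/properP; split; first exact: finset.subsetT.
    by exists v; rewrite ?finset.in_setT // !finset.inE eqxx.
  move=> S _ S0; have [||w] := hG [set val x | x in S]%SET.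
  - exact: finset.subsetT.
  - have /set0Pn[x xS] := S0; apply/set0Pn.
    by exists (val x); exact: imset_f.
  case/imsetP => x xS -> hx; exists x => //.
  case: hx => h; [left|right] => y yS yx.
    by apply: (h (val y)); rewrite ?imset_f // (inj_eq val_inj).
  by apply: (h (val y)); rewrite ?imset_f // (inj_eq val_inj).
case: hv => hv; [apply: (@threshold_isolated _ v)|apply: (@threshold_dominating _ v)] => //.
  by apply/forallP => u; apply/implyP; apply: hv; rewrite finset.in_setT.
by apply/forallP => u; apply/implyP; apply: hv; rewrite finset.in_setT.
Qed.

End Threshold.

(** * From Hanner polytopes to threshold graphs *)

Section Peeling.
Variables (R : realType) (G : sgraph).

Local Notation N := (1 + #|G|)%N.
Local Notation vert := (@vert R G).
Local Notation hansen := (@hansen R G).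
Local Notation cvec := (@cvec R G).
Implicit Types (x y : 'rV[R]_N) (S I C : {set G}) (v i j : G).

(** A decomposition of the polytope separates from [S] a set of vertices that
    are all isolated or all dominating in [S]. *)
Definition homogeneous_split S := exists S', [/\ S' \proper S,
  @Hanner_in R G (hansen S') &
  (forall i j, i \in S -> i \notin S' -> j \in S -> ~~ edge i j) \/
  (forall i j, i \in S -> i \notin S' -> j \in S -> j != i -> edge i j)].

Lemma row_free_col_mx m n (A1 : 'M[R]_(m, N)) (A2 : 'M[R]_(n, N))
    (p : 'rV_m) (q : 'rV_n) :
  row_free (col_mx A1 A2) -> p *m A1 = q *m A2 -> p = 0 /\ q = 0.
Proof.
move=> fA E; have : row_mx p (- q) = 0.
  by apply: (row_free_inj fA); rewrite /= mul_row_col mul0mx mulNmx E subrr.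
rewrite -row_mx0 => /eq_row_mx[-> /eqP].
by rewrite oppr_eq0 => /eqP.
Qed.

Lemma hansen_not_segment S a (A : 'M[R]_(1, N)) : S != finset.set0 ->
  hansen S <> [set z *m A | z in segment a].
Proof.
move=> /set0Pn[i iS] hS.
have := hansen_vert (R := R) (stable0 G) (finset.sub0set S).
have := @hansen_vert R G S _ (stable1 i); rewrite finset.sub1set => /(_ iS).
rewrite hS => -[z _ zE] [w _ wE].
have E : z 0 0 *: vert finset.set0 = w 0 0 *: vert [set i]%SET.
  rewrite -zE -wE [in RHS](mx11_scalar z) [in LHS](mx11_scalar w).
  by rewrite !mul_scalar_mx !scalerA mulrC.
have := congr1 (@height R G) E; have := congr1 (@coord R G i) E.
rewrite !lin finset.in_set0 finset.set11 !mulr1 mulr0 => <- z0.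
have := congr1 (@height R G) zE.
by rewrite [z]mx11_scalar z0 mul_scalar_mx scale0r !lin => /eqP; rewrite eq_sym oner_eq0.
Qed.

(** The roles of the two factors are distinguished by the empty set: its form,
    respectively its vertex, belongs to only one of them. *)
Lemma Hanner_split S : S != finset.set0 -> @Hanner_in R G (hansen S) ->
  homogeneous_split S.
Proof.
move=> S0 [d [Q [A [hQ fA hS]]]].
pose T d (Q : set 'rV[R]_d) := forall A : 'M[R]_(d, N), row_free A ->
  hansen S = [set z *m A | z in Q] -> homogeneous_split S.
suff : T d Q by move/(_ A); apply.
apply: std_Hanner_shape hQ => {d Q A fA hS}.
- by move=> a a0 A _ /hansen_not_segment; case.
- move=> m n P Q hP hQ A; rewrite -(vsubmxK A).
  move: (usubmx A) (dsubmx A) => A1 A2 fA hS.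
  have inj12 := row_free_col_mx fA.
  have bP := std_Hanner_body hP; have bQ := std_Hanner_body hQ.
  have bPQ := body_product bP bQ.
  have supp p q v : v \notin S -> coord v (p *m A1 + q *m A2) = 0.
    by rewrite -mul_row_col; exact: hansen_coord_im hS.
  have hX x : hansen S x <-> exists p q, [/\ P p, Q q & x = p *m A1 + q *m A2].
    rewrite hS; split=> [[_ [p Pp [q Qq <-]] <-]|[p [q [Pp Qq ->]]]].
      by exists p, q; rewrite mul_row_col.
    by exists (row_mx p q); rewrite ?mul_row_col //; apply/direct_productE.
  have hF C : clique C -> (forall p, dot (p *m A1) (cvec C) = 0) \/
                          (forall q, dot (q *m A2) (cvec C) = 0).
    move=> /(clique_extreme bPQ fA hS).
    rewrite tr_col_mx mul_mx_row => /(extreme_polar_product bP bQ) [h|h].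
      by left=> p; rewrite -dot_mulmx h dot0r.
    by right=> q; rewrite -dot_mulmx h dot0r.
  have swap x : hansen S x <-> exists q p, [/\ Q q, P p & x = q *m A2 + p *m A1].
    rewrite hX; split=> [[p [q [? ? ->]]]|[q [p [? ? ->]]]].
      by exists q, p; rewrite addrC.
    by exists p, q; rewrite addrC.
  case: (hF _ (clique0 G)) => h.
    have [|||p|S' [? ? ?]] := @product_split R G _ _ A2 A1 S (std_Hanner_dim_gt0 hP)
      _ _ _ _ hQ hP swap.
    + by move=> q p /esym /inj12[].
    + by move=> p v /(supp p 0); rewrite mul0mx addr0.
    + by move=> C /hF[]; [right|left].
    + by have := h p; rewrite dot_cvec0 => /eqP; rewrite oppr_eq0 => /eqP.
    + by exists S'; split=> //; left.
  have [|||q|S' [? ? ?]] := @product_split R G _ _ A1 A2 S (std_Hanner_dim_gt0 hQ)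
    _ _ _ _ hP hQ hX.
  + exact: inj12.
  + by move=> q v /(supp 0 q); rewrite mul0mx add0r.
  + exact: hF.
  + by have := h q; rewrite dot_cvec0 => /eqP; rewrite oppr_eq0 => /eqP.
  + by exists S'; split=> //; left.
- move=> m n P Q hP hQ A; rewrite -(vsubmxK A).
  move: (usubmx A) (dsubmx A) => A1 A2 fA hS.
  have inj12 := row_free_col_mx fA.
  have bP := std_Hanner_body hP; have bQ := std_Hanner_body hQ.
  have bPQ := body_polar (body_product bP bQ).
  have supp p q v : v \notin S -> coord v (p *m A1 + q *m A2) = 0.
    by rewrite -mul_row_col; exact: hansen_coord_im hS.
  have hX x : hansen S x <-> exists p q,
      [/\ forall (a : 'rV_m) (b : 'rV_n), P a -> Q b -> dot a p + dot b q <= 1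
        & x = p *m A1 + q *m A2].
    rewrite hS; split=> [[z hz <-]|[p [q [/polar_productE pq ->]]]].
      exists (lsubmx z), (rsubmx z); rewrite -mul_row_col hsubmxK; split=> //.
      by apply/polar_productE; rewrite hsubmxK.
    by exists (row_mx p q); rewrite ?mul_row_col.
  have swap x : hansen S x <-> exists q p,
      [/\ forall (b : 'rV_n) (a : 'rV_m), Q b -> P a -> dot b q + dot a p <= 1
        & x = q *m A2 + p *m A1].
    rewrite hX; split=> [[p [q [h ->]]]|[q [p [h ->]]]].
      by exists q, p; split; rewrite 1?addrC // => b a Qb Pa; rewrite addrC h.
    by exists p, q; split; rewrite 1?addrC // => b a Qb Pa; rewrite addrC h.
  have hF I : stable I -> I \subset S ->
      (exists p, vert I = p *m A1) \/ (exists q, vert I = q *m A2).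
    move=> sI IS; have [z] := stable_extreme fA hS sI IS.
    rewrite -(hsubmxK z) => /(extreme_polar_product bP bQ) [->|->] ->.
      by right; exists (rsubmx z); rewrite mul_row_col mul0mx add0r.
    by left; exists (lsubmx z); rewrite mul_row_col mul0mx addr0.
  have free1 : row_free A1.
    apply: inj_row_free => p p0; have [] // := inj12 p 0 _.
    by rewrite mul0mx.
  have free2 : row_free A2.
    apply: inj_row_free => q q0; have [] // := inj12 0 q _.
    by rewrite mul0mx.
  case: (hF _ (stable0 G) (finset.sub0set S)) => h.
    have [|||S' [? ? ?]] := @sum_split R G _ _ A1 A2 S (std_Hanner_dim_gt0 hQ)
      _ _ _ _ hP hQ hX free1 _ h.
    + exact: inj12.
    + by move=> q v /(supp 0 q); rewrite mul0mx add0r.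
    + exact: hF.
    + by exists S'; split=> //; right.
  have [|||S' [? ? ?]] := @sum_split R G _ _ A2 A1 S (std_Hanner_dim_gt0 hP)
    _ _ _ _ hQ hP swap free2 _ h.
  + by move=> q p /esym /inj12[].
  + by move=> p v /(supp p 0); rewrite mul0mx addr0.
  + by move=> I sI IS; case: (hF I sI IS); [right|left].
  + by exists S'; split=> //; right.
Qed.

(** The vertices split off remain isolated, or dominating, in each subset that
    contains one of them. *)
Lemma Hanner_peelable S : @Hanner_in R G (hansen S) -> peelable S.
Proof.
have [k ltSk] := ubnP #|S|; elim: k S ltSk => // k IH S ltSk hS T TS T0.
have S0 : S != finset.set0.
  by apply: contraNneq T0 => S0; rewrite -finset.subset0 -S0.
have [S' [S'S hS' hom]] := Hanner_split S0 hS.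
have pS' : peelable S' by apply: IH hS'; exact: leq_trans (proper_card S'S) _.
case: (boolP (T \subset S')) => [|/subsetPn[i iT iS']]; first by move/pS'; apply.
have iS := fintype.subsetP TS _ iT.
exists i => //; case: hom => h; [left|right] => j jT ji; apply: h => //;
  exact: (fintype.subsetP TS).
Qed.

End Peeling.

(** * From threshold graphs to Hanner polytopes *)

Section Construction.
Variables (R : realType) (G : sgraph).

Local Notation N := (1 + #|G|)%N.
Local Notation vert := (@vert R G).
Local Notation hansen := (@hansen R G).
Local Notation Hanner_in := (@Hanner_in R G).
Implicit Types (x y : 'rV[R]_N) (S I C : {set G}) (v i j : G).

Lemma Hanner_hansen0 : Hanner_in (hansen finset.set0).
Proof.
exists 1%N, (segment 1), (vert finset.set0).
have E (r : 'rV[R]_1) : r *m vert finset.set0 = r 0 0 *: vert finset.set0.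
  by rewrite [in LHS](mx11_scalar r) mul_scalar_mx.
split; first by apply: std_Hanner_segment; exact: ltr01.
  apply: inj_row_free => r; rewrite E => /(congr1 (@height R G)).
  rewrite !lin mulr1 => r0; apply/rowP => k.
  by rewrite (ord1 k) r0 mxE.
apply/seteqP; split=> [x|_ [r /= /andP[r1 r2] <-]].
  move: x; apply: (@hansen_min _ _ _ [set z *m vert finset.set0 | z in segment 1]).
    move=> t x y t0 t1 [r /= /andP[r1 r2] <-] [s /= /andP[s1 s2] <-].
    exists (t *: r + (1 - t) *: s); last by rewrite mulmxDl -!scalemxAl.
    by rewrite /segment /= !mxE; apply/andP; split; nra.
  move=> I _; rewrite finset.subset0 => /eqP ->.
  split; [exists 1%:M|exists (- 1%:M)]; rewrite ?mulNmx ?mul1mx // /segment /= !mxE /=.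
    by apply/andP; split; lra.
  by apply/andP; split; lra.
have -> : r *m vert finset.set0 = ((1 + r 0 0) / 2) *: vert finset.set0 +
    (1 - (1 + r 0 0) / 2) *: - vert finset.set0.
  by rewrite E scalerN -scalerBl; congr (_ *: _); lra.
apply: hansen_convex; try lra.
  by apply: hansen_vert; rewrite ?stable0.
by apply: hansen_vertN; rewrite ?stable0.
Qed.

Lemma unit_vec v : exists u : 'rV[R]_N,
  [/\ height u = 0, forall w, coord w u = (w == v)%:R &
      forall I, v \notin I -> vert (v |: I)%SET = vert I + u].
Proof.
exists (vert [set v]%SET - vert finset.set0); split=> [|w|I vI].
- by rewrite !lin subrr.
- by rewrite !lin finset.in_set0 subr0 finset.in_set1.
apply: coordP => [|w]; rewrite !lin ?subrr ?addr0 //.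
rewrite finset.in_set0 subr0 finset.in_set1 finset.in_setU1.
by case: eqVneq => [->|_]; rewrite /= ?(negPf vI) ?add0r ?addr0.
Qed.

(** The stable set polytope of the graph with the isolated vertex [v] is a
    prism. With [e] the unit vector of [v], the shear [x + (height x / 2) *: e]
    maps each vertex [vert I] of the polytope without [v] to the midpoint of
    [vert I] and [vert (v |: I)], and similarly for their opposites; the whole
    polytope is thus its sheared part plus a centered segment. *)
Lemma Hanner_isolated S v : v \in S ->
  (forall u, u \in S -> u != v -> ~~ edge v u) ->
  Hanner_in (hansen (S :\ v)%SET) -> Hanner_in (hansen S).
Proof.
move=> vS iso [d [Q [A [hQ fA hS]]]].
have bQ := std_Hanner_body hQ.
have [e [height_e coord_e vert_setU1]] := unit_vec v.
pose shear x := x + (height x / 2) *: e.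
have shearL t s x y : shear (t *: x + s *: y) = t *: shear x + s *: shear y.
  rewrite /shear !lin !scalerDr !scalerA addrACA -scalerDl.
  by congr (_ + _ *: _); ring.
have shearN x : shear (- x) = - shear x.
  by rewrite /shear !lin mulNr scaleNr opprD.
have shearV I : shear (vert I) = vert I + 2^-1 *: e.
  by rewrite /shear lin mul1r.
pose Sh : 'M[R]_N := 1%:M + 2^-1 *: (delta_mx (lshift _ 0) 0 *m e).
have ShE x : x *m Sh = shear x.
  rewrite mulmxDr mulmx1 -scalemxAr mulmxA -colE (mx11_scalar (col _ _)).
  by rewrite mul_scalar_mx scalerA mxE mulrC.
pose A' := col_mx (A *m Sh) (2^-1 *: e).
have AE q (r : 'rV_1) :
    row_mx q r *m A' = shear (q *m A) + (r 0 0 / 2) *: e.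
  rewrite mul_row_col mulmxA ShE {1}(mx11_scalar r) mul_scalar_mx scalerA.
  by [].
have vNS' : v \notin (S :\ v)%SET by rewrite finset.in_setD1 eqxx.
have S'S : (S :\ v)%SET \subset S by exact: finset.subD1set.
exists (d + 1)%N, (direct_product Q (segment 1)), A'; split.
- by apply: std_Hanner_product => //; apply: std_Hanner_segment; exact: ltr01.
- apply: inj_row_free => z; rewrite -(hsubmxK z) AE.
  move: (lsubmx z) (rsubmx z) => q r E.
  have hq : height (q *m A) = 0.
    have := congr1 (@height R G) E.
    by rewrite /shear !heightD !heightZ height_e height0 !mulr0 !addr0.
  move: E; rewrite /shear hq mul0r scale0r addr0 => E.
  have r0 : r 0 0 = 0.
    have := congr1 (@coord R G v) E.
    rewrite coordD coordZ coord_e eqxx (hansen_coord_im _ bQ hS) // coord0.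
    by rewrite mulr1 add0r; lra.
  move: E; rewrite r0 mul0r scale0r addr0 => qA.
  have -> : q = 0 by apply: (row_free_inj fA); rewrite /= qA mul0mx.
  have -> : r = 0 by apply/rowP => k; rewrite (ord1 k) r0 mxE.
  exact: row_mx0.
pose prism := [set x | exists y r, [/\ hansen (S :\ v)%SET y, -1 <= r, r <= 1 &
  x = shear y + (r / 2) *: e]].
have -> : [set z *m A' | z in direct_product Q (segment 1)] = prism.
  apply/seteqP; split=> [_ [z [q Qq [r /andP[r1 r2] <-]] <-]|x].
    by exists (q *m A), (r 0 0); split; rewrite ?AE // hS; exists q.
  move=> [y [r []]]; rewrite hS => -[q Qq <-] r1 r2 ->.
  exists (row_mx q r%:M); last by rewrite AE mxE.
  by apply/direct_productE; split; rewrite // /segment /= mxE r1.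
apply/seteqP; split; last first.
  (* the two bases of the prism are in the polytope *)
  have key y : hansen (S :\ v)%SET y ->
      hansen S (shear y + 2^-1 *: e) /\
      hansen S (shear y - 2^-1 *: e).
    move: y; apply: (@hansen_min _ _ _ [set y |
        hansen S (shear y + 2^-1 *: e) /\
        hansen S (shear y - 2^-1 *: e)]) => /=.
      move=> t x y t0 t1 [x1 x2] [y1 y2]; rewrite shearL.
      have E (z : 'rV[R]_N) : z = t *: z + (1 - t) *: z.
        by rewrite -scalerDl addrC subrK scale1r.
      by split; rewrite [X in _ + X]E addrACA -!scalerDr; exact: hansen_convex.
    move=> I sI IS'.
    have vI : v \notin I by apply: contraNN vNS' => /(fintype.subsetP IS').
    have IS := fintype.subset_trans IS' S'S.
    have sI' : stable (v |: I)%SET.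
      have nv u : u \in I -> ~~ edge v u.
        move=> uI; apply: iso; first exact: (fintype.subsetP IS).
        by apply: contraNneq vI => <-.
      apply/stableP => i j; rewrite !finset.in_setU1.
      case/predU1P => [->|iI]; case/predU1P => [->|jI].
      - by rewrite edge_irrefl.
      - exact: nv.
      - by rewrite edge_sym; exact: nv.
      - exact: (stableP _ sI).
    have IS'' : (v |: I)%SET \subset S by rewrite finset.subUset finset.sub1set vS.
    have half : e = 2^-1 *: e + 2^-1 *: e.
      by rewrite -scalerDl -[LHS]scale1r; congr (_ *: _); lra.
    rewrite shearN shearV -addrA -half -vert_setU1 // addrK.
    rewrite opprD subrK -addrA -opprD -half -opprD -vert_setU1 //.
    by split; split; (apply: hansen_vert || apply: hansen_vertN).
  move=> _ [y [r [Hy r1 r2 ->]]]; have [] := key y Hy.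
  move: (shear y) => w h1 h2.
  have -> : w + (r / 2) *: e = ((1 + r) / 2) *: (w + 2^-1 *: e) +
      (1 - (1 + r) / 2) *: (w - 2^-1 *: e).
    rewrite !scalerDr addrACA -scalerDl scalerN -scaleNr !scalerA -scalerDl.
    by rewrite [_ + (1 - _)]addrC subrK scale1r; congr (_ + _ *: _); field.
  by apply: hansen_convex => //; lra.
apply: hansen_min.
  move=> t x y t0 t1 [x' [r [Hx r1 r2 ->]]] [y' [s [Hy s1 s2 ->]]].
  exists (t *: x' + (1 - t) *: y'), (t * r + (1 - t) * s); split.
  - exact: hansen_convex.
  - by nra.
  - by nra.
  - rewrite shearL; move: (shear x') (shear y') => z w.
    rewrite !scalerDr addrACA !scalerA -scalerDl.
    by congr (_ + _ *: _); ring.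
move=> I sI IS.
have IS' : (I :\ v)%SET \subset (S :\ v)%SET by exact: finset.setSD.
have sI' : stable (I :\ v)%SET by apply: stableS sI; exact: finset.subD1set.
case: (boolP (v \in I)) => vI.
  have IE : vert I = vert (I :\ v)%SET + e.
    by rewrite -vert_setU1 ?finset.in_setD1 ?eqxx // finset.setD1K.
  split; [exists (vert (I :\ v)%SET), 1|exists (- vert (I :\ v)%SET), (-1)].
    split; rewrite ?shearV ?IE -?addrA -?scalerDl; [exact: hansen_vert|lra|lra|].
    by rewrite -[in LHS](scale1r e); congr (_ + _ *: _); lra.
  split; rewrite ?shearN ?shearV ?IE ?opprD -?addrA -?scaleNr -?scalerDl;
    [exact: hansen_vertN|lra|lra|].
  by rewrite -[X in _ - X]scale1r -scaleNr; congr (_ + _ *: _); lra.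
have IE : (I :\ v)%SET = I by apply/finset.setDidPl; rewrite disjoint_sym disjoints1.
rewrite {}IE in IS' sI'.
split; [exists (vert I), (-1)|exists (- vert I), 1].
  split; rewrite ?shearV -?addrA -?scalerDl; [exact: hansen_vert|lra|lra|].
  by rewrite -[LHS]addr0 -(scale0r e); congr (_ + _ *: _); lra.
split; rewrite ?shearN ?shearV ?opprD -?addrA -?scaleNr -?scalerDl;
  [exact: hansen_vertN|lra|lra|].
by rewrite -[LHS]addr0 -(scale0r e); congr (_ + _ *: _); lra.
Qed.

(** Only the singleton among the stable sets contains the dominating vertex
    [v], so the polytope is the free sum of the polytope without [v] and a
    segment, which is the polar of a product. *)
Lemma Hanner_dominating S v : v \in S ->
  (forall u, u \in S -> u != v -> edge v u) ->
  Hanner_in (hansen (S :\ v)%SET) -> Hanner_in (hansen S).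
Proof.
move=> vS dom [d [Q [A [hQ fA hS]]]].
have bQ := std_Hanner_body hQ; have [_ aQ' bpQ] := bQ.
have h1 : std_Hanner (segment (1 : R)) by apply: std_Hanner_segment; exact: ltr01.
have vNS' : v \notin (S :\ v)%SET by rewrite finset.in_setD1 eqxx.
have S'S : (S :\ v)%SET \subset S by exact: finset.subD1set.
pose A' := col_mx A (vert [set v]%SET).
have AE q (r : 'rV_1) : row_mx q r *m A' = q *m A + r 0 0 *: vert [set v]%SET.
  by rewrite mul_row_col {1}(mx11_scalar r) mul_scalar_mx.
pose Q' := polar (direct_product (polar Q) (segment (1 : R))).
have v1S : [set v]%SET \subset S by rewrite finset.sub1set.
exists (d + 1)%N, Q', A'; split.
- apply: std_Hanner_polarW; apply: std_Hanner_product => //.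
  exact: std_Hanner_polarW.
- apply: inj_row_free => z; rewrite -(hsubmxK z) AE.
  move: (lsubmx z) (rsubmx z) => q r E.
  have r0 : r 0 0 = 0.
    have := congr1 (@coord R G v) E.
    rewrite coordD coordZ coord_vert finset.set11 (hansen_coord_im _ bQ hS) // coord0.
    by rewrite mulr1 add0r.
  move: E; rewrite r0 scale0r addr0 => qA.
  have -> : q = 0 by apply: (row_free_inj fA); rewrite /= qA mul0mx.
  have -> : r = 0 by apply/rowP => k; rewrite (ord1 k) r0 mxE.
  exact: row_mx0.
apply/seteqP; split.
  apply: hansen_min.
    move=> t x y t0 t1 [z Qz <-] [w Qw <-]; exists (t *: z + (1 - t) *: w).
      exact: polar_convex.
    by rewrite mulmxDl -!scalemxAl.
  have base x : hansen (S :\ v)%SET x -> [set z *m A' | z in Q'] x.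
    rewrite hS => -[q Qq <-]; exists (row_mx q 0).
      apply/polar_productE => p s Pp _; rewrite dot0r addr0 dotC; exact: Pp.
    by rewrite AE mxE scale0r addr0.
  have apex (r : R) : -1 <= r -> r <= 1 -> [set z *m A' | z in Q'] (r *: vert [set v]%SET).
    move=> r1 r2; exists (row_mx 0 r%:M); last by rewrite AE mul0mx add0r mxE.
    apply/polar_productE => p s _ /andP[s1 s2]; rewrite dot0r add0r dot1 mxE /=.
    by rewrite mulr1n; nra.
  move=> I sI IS; case: (boolP (v \in I)) => vI.
    have -> : I = [set v]%SET.
      apply/eqP; rewrite finset.eqEsubset finset.sub1set vI andbT.
      apply/fintype.subsetP => u uI; rewrite finset.in_set1.
      apply/negPn/negP => uv; have := dom u (fintype.subsetP IS _ uI) uv.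
      by rewrite (negPf (stableP _ sI v u vI uI)).
    rewrite -scaleN1r -[X in _ X /\ _]scale1r.
    by split; apply: apex; lra.
  have IS' : I \subset (S :\ v)%SET by rewrite subsetD1 IS.
  by split; apply: base; [exact: hansen_vert|exact: hansen_vertN].
move=> _ [z + <-]; rewrite -(hsubmxK z) AE.
move: (lsubmx z) (rsubmx z) => q r /polar_productE pq.
(* [w] is the apex on the side of the last coordinate, [t] its weight *)
have [t [w [t0 Hw rE tE]]] : exists t w, [/\ 0 <= t, hansen S w,
    r 0 0 *: vert [set v]%SET = t *: w &
    forall p, polar Q p -> dot p q <= 1 - t].
  case: (lerP 0 (r 0 0)) => r0.
    exists (r 0 0), (vert [set v]%SET); split=> //.
      by apply: hansen_vert; rewrite ?stable1.
    move=> p Pp; have := pq p 1%:M Pp; rewrite dot1 mxE /= mulr1n mul1r => h.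
    have := h _; rewrite /segment /= mxE /= mulr1n.
    by rewrite lexx andbT => /(_ ltac:(lra)); lra.
  exists (- r 0 0), (- vert [set v]%SET); split=> //.
  - by rewrite oppr_ge0 ltW.
  - by apply: hansen_vertN; rewrite ?stable1.
  - by rewrite scaleNr scalerN opprK.
  move=> p Pp; have := pq p (- 1%:M) Pp; rewrite dot1 !mxE /= mulr1n mulN1r => h.
  have := h _; rewrite /segment /= !mxE /= mulr1n.
  by rewrite lexx /= => /(_ ltac:(lra)); lra.
rewrite rE.
have t1 : t <= 1.
  by have := tE 0 (body0 (body_polar bQ)); rewrite dot0l; lra.
case: (eqVneq t 1) => [tt|tt].
  have [e e0 Pe] := aQ' q.
  have q0 : q = 0.
    apply/eqP/negPn/negP => /dot_gt0 qq.
    by have := tE _ Pe; rewrite tt dotZl; nra.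
  by rewrite q0 mul0mx add0r tt scale1r.
have t1' : 0 < 1 - t by rewrite subr_gt0 lt_neqAle tt.
have Qq : Q ((1 - t)^-1 *: q).
  rewrite -bpQ => p Pp; rewrite -/(dot _ _) dotZr mulrC ler_pdivrMr // mul1r.
  exact: tE.
have -> : q *m A + t *: w = t *: w + (1 - t) *: (((1 - t)^-1 *: q) *m A).
  by rewrite -scalemxAl scalerA divff ?gt_eqF // scale1r addrC.
apply: hansen_convex => //; apply: (hansen_mono S'S).
by rewrite hS; exists ((1 - t)^-1 *: q).
Qed.

Lemma peelable_Hanner S : peelable S -> Hanner_in (hansen S).
Proof.
have [k ltSk] := ubnP #|S|; elim: k S ltSk => // k IH S ltSk hS.
case: (eqVneq S finset.set0) => [->|S0]; first exact: Hanner_hansen0.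
have [v vS hv] := hS S (fintype.subxx S) S0.
have hS' : Hanner_in (hansen (S :\ v)%SET).
  apply: IH; last by apply: peelableS hS; exact: finset.subD1set.
  by move: ltSk; rewrite (cardsD1 v) vS.
by case: hv => hv; [apply: (@Hanner_isolated S v)|apply: (@Hanner_dominating S v)].
Qed.

(** * The Hansen polytope of the whole graph *)

Lemma HansenE : Hansen R G = hansen [set: G]%SET.
Proof.
apply/seteqP; split.
  apply: conv_hull_min; first exact: hansen_convex.
  have stabH (p : 'rV[R]_#|G|) : stab R G p ->
      hansen [set: G]%SET (row_mx 1%:M p) /\ hansen [set: G]%SET (- row_mx 1%:M p).
    move: p; apply: (@conv_hull_min R _ _ [set p |
       hansen [set: G]%SET (row_mx 1%:M p) /\ hansen [set: G]%SET (- row_mx 1%:M p)]) => /=.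
      move=> t x y t0 t1 [x1 x2] [y1 y2].
      have -> : row_mx 1%:M (t *: x + (1 - t) *: y) =
          t *: row_mx 1%:M x + (1 - t) *: row_mx 1%:M y :> 'rV[R]_N.
        by rewrite !scale_row_mx add_row_mx -scalerDl [t + _]addrC subrK scale1r.
      by split; rewrite ?opprD -?scalerN; exact: hansen_convex.
    move=> _ [I sI <-]; split; [exact: hansen_vert|exact: hansen_vertN].
  by move=> x [[p /stabH[] ? _ <-]|[_ [p /stabH[] _ ? <-] <-]].
apply: hansen_min; first exact: convex_conv_hull.
move=> I sI _; have pI : stab R G (incidence R I) by apply: sub_conv_hull; exists I.
split; apply: sub_conv_hull; [left|right].
  by exists (incidence R I).
by exists (vert I) => //; exists (incidence R I).
Qed.

(** The polytope of the whole graph spans the ambient space, so that the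
    embedding of the standard polytope is a change of coordinates. *)
Lemma HannerE (S := [set: G]%SET) : Hanner (hansen S) <-> Hanner_in (hansen S).
Proof.
split=> [[Q [A [hQ uA hS]]]|[d [Q [A [hQ fA hS]]]]].
  by exists N, Q, A; rewrite row_free_unit.
have full : row_full A.
  rewrite -sub1mx; apply/row_subP => k; rewrite row1.
  have vA I : stable I -> (vert I <= A)%MS.
    move=> sI; have := hansen_vert (R := R) sI (finset.subsetT I).
    by rewrite -/S hS => -[z _ <-]; exact: submxMl.
  apply: (@submx_span_vert _ _ S) => [v||i _]; rewrite ?vA ?stable0 ?stable1 //.
  by rewrite finset.in_setT.
have dN : d = N by apply: etrans (eqP full); exact/esym/eqP.
move: Q A hQ fA hS {full}; rewrite dN => Q A hQ fA hS.
by exists Q, A; rewrite -row_free_unit.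
Qed.

End Construction.

Theorem theorem3p3 (R : realType) (G : sgraph) :
  perfect G -> (Hanner (Hansen R G) <-> threshold G).
Proof.
move=> _; rewrite HansenE HannerE; split.
  by move=> /Hanner_peelable /peelable_threshold.
by move=> /threshold_peelable /peelable_Hanner.
Qed.
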